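(* Let $k$ be an algebraically closed field (of arbitrary characteristic), let $G$ be an affine algebraic group over $k$, and let $J\in Z^2_{\mathrm{inv}}(G)$ be an invariant Hopf $2$-cocycle for $G$ with support $A:=\mathrm{Supp}(J)$. Then $A$ is a closed normal commutative subgroup of $G$.
   Context: For a Hopf algebra $H$ over $k$ (Sweedler notation), $H^*$ and $(H\otimes H)^*$ are algebras under convolution $*$. A Hopf $2$-cocycle for $H$ is an invertible $J\in(H\otimes H)^*$ with $\sum J(a_1b_1,c)J(a_2,b_2)=\sum J(a,b_1c_1)J(b_2,c_2)$ and $J(a,1)=\varepsilon(a)=J(1,a)$ for all $a,b,c\in H$. It is invariant if $\sum J(a_1,b_1)a_2b_2=\sum a_1b_1J(a_2,b_2)$ for all $a,b$; $Z^2_{\mathrm{inv}}(H)$ is the set (group) of invariant ones. For $x\in(H^* )^\times$, $J^x(a,b)=\sum x(a_1b_1)J(a_2,b_2)x^{-1}(a_3)x^{-1}(b_3)$; $J$ and $J^x$ are called gauge equivalent. $H^J$ is the Hopf algebra equal to $H$ as a coalgebra with product $m^J=J^{-1}*m*J$. A cotriangular Hopf algebra $(H,R)$ is a Hopf algebra with an invertible $R\in(H\otimes H)^*$ such that $\sum R(h_1,g_1)R(g_2,h_2)=\varepsilon(g)\varepsilon(h)$, $R(h,gl)=\sum R(h_1,g)R(h_2,l)$, $R(hg,l)=\sum R(g,l_1)R(h,l_2)$ and $\sum R(h_1,g_1)g_2h_2=\sum h_1g_1R(h_2,g_2)$. It is minimal if $R$ is non-degenerate as a bilinear form. A Hopf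 $2$-cocycle for an affine algebraic group $G$ means one for $\mathcal O(G)$, and $Z^2_{\mathrm{inv}}(G):=Z^2_{\mathrm{inv}}(\mathcal O(G))$. A Hopf $2$-cocycle $J$ for $G$ is minimal if $(\mathcal O(G)^J,J_{21}^{-1}*J)$ is a minimal cotriangular Hopf algebra, where $J_{21}(a,b)=J(b,a)$. If $H\subseteq G$ is a closed subgroup, a Hopf $2$-cocycle for $H$ is viewed as one for $G$ by pulling back along the restriction $\mathcal O(G)\to\mathcal O(H)$. The support $\mathrm{Supp}(J)$ of a Hopf $2$-cocycle $J$ for $G$ is the closed subgroup $H\subseteq G$, which exists and is unique up to conjugation in $G$, such that $J$ is gauge equivalent to a minimal Hopf $2$-cocycle for $H$ viewed as a Hopf $2$-cocycle for $G$. *)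

(* Defs.v *)
From mathcomp Require Import all_boot all_order all_algebra.

Set Implicit Arguments.
Unset Strict Implicit.
Unset Printing Implicit Defensive.

Import GRing.Theory.
Local Open Scope ring_scope.

(* Coproducts.  An element of H (x) H is represented by a finite list of pairs
   [:: (x_1, y_1); ...; (x_n, y_n)], standing for \sum_i x_i (x) y_i, and is
   only ever used through the values \sum_i B x_i y_i of bilinear maps B (with
   values in an arbitrary vector space).  By the universal property of the
   tensor product these values determine the element, so that an equality in
   H (x) H is stated as an equality of the values of every bilinear map; the
   choice of representatives is irrelevant.  Similarly for H (x) H (x) H. *)

(* The data underlying a bialgebra.  The product is a mere function, rather
   than a ring structure on the carrier, because H and its cocycle twists are
   to live on the same space. *)
Record bialgData (k : fieldType) := BialgData {
  bcarrier :> lmodType k;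
  bone : bcarrier;
  bmul : bcarrier -> bcarrier -> bcarrier;
  bcomul : bcarrier -> seq (bcarrier * bcarrier);
  bcounit : bcarrier -> k }.

Section Hopf.
Variables (k : fieldType) (H : bialgData k).

Local Notation one := (bone H).
Local Notation "a ** b" := (bmul a b) (at level 40, left associativity).
Local Notation Delta := (@bcomul k H).
Local Notation eps := (@bcounit k H).

Definition trilinear (U : lmodType k) (T : H -> H -> H -> U) : Prop :=
  [/\ forall b c, linear (fun a => T a b c),
      forall a c, linear (fun b => T a b c) &
      forall a b, linear (fun c => T a b c)].

(* \sum h_1 (x) h_2 (x) h_3, as (id (x) Delta) (Delta h) *)
Definition bcomul3 (h : H) : seq (H * H * H) :=
  [seq (p.1, q.1, q.2) | p <- Delta h, q <- Delta p.2].

Definition is_algebra : Prop :=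
  [/\ bilinear_for *:%R *:%R (@bmul k H),
      forall a b c : H, a ** (b ** c) = (a ** b) ** c,
      forall a : H, one ** a = a &
      forall a : H, a ** one = a].

Definition is_coalgebra : Prop :=
  [/\ forall (U : lmodType k) (B : H -> H -> U), bilinear_for *:%R *:%R B ->
        linear (fun h => \sum_(p <- Delta h) B p.1 p.2),
      forall (U : lmodType k) (T : H -> H -> H -> U), trilinear T ->
        forall h, \sum_(p <- Delta h) \sum_(q <- Delta p.1) T q.1 q.2 p.2
                = \sum_(p <- Delta h) \sum_(q <- Delta p.2) T p.1 q.1 q.2,
      scalar eps,
      forall h, \sum_(p <- Delta h) eps p.1 *: p.2 = h &
      forall h, \sum_(p <- Delta h) eps p.2 *: p.1 = h].

Definition is_bialgebra : Prop :=
  [/\ is_algebra /\ is_coalgebra,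
      forall (U : lmodType k) (B : H -> H -> U), bilinear_for *:%R *:%R B ->
        \sum_(p <- Delta one) B p.1 p.2 = B one one,
      forall (U : lmodType k) (B : H -> H -> U), bilinear_for *:%R *:%R B ->
        forall a b, \sum_(p <- Delta (a ** b)) B p.1 p.2
          = \sum_(p <- Delta a) \sum_(q <- Delta b) B (p.1 ** q.1) (p.2 ** q.2),
      eps one = 1 &
      forall a b, eps (a ** b) = eps a * eps b].

Definition is_antipode (S : H -> H) : Prop :=
  [/\ linear S,
      forall h, \sum_(p <- Delta h) S p.1 ** p.2 = eps h *: one &
      forall h, \sum_(p <- Delta h) p.1 ** S p.2 = eps h *: one].

Definition is_hopf : Prop :=
  is_bialgebra /\ exists S : H -> H, is_antipode S.

Definition conv1 (x y : H -> k) (h : H) : k :=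
  \sum_(p <- Delta h) x p.1 * y p.2.

Definition conv2 (X Y : H -> H -> k) (a b : H) : k :=
  \sum_(p <- Delta a) \sum_(q <- Delta b) X p.1 q.1 * Y p.2 q.2.

Definition transp (X : H -> H -> k) (a b : H) : k := X b a.

(* y is the inverse of x in the convolution algebra H^* *)
Definition inverse1 (x y : H -> k) : Prop :=
  [/\ scalar x, scalar y,
      forall h, conv1 x y h = eps h & forall h, conv1 y x h = eps h].

(* Y is the inverse of X in the convolution algebra (H (x) H)^* *)
Definition inverse2 (X Y : H -> H -> k) : Prop :=
  [/\ bilinear_for *%R *%R X, bilinear_for *%R *%R Y,
      forall a b, conv2 X Y a b = eps a * eps b &
      forall a b, conv2 Y X a b = eps a * eps b].

Definition hopf_2cocycle (J : H -> H -> k) : Prop :=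
  [/\ exists K, inverse2 J K,
      forall a b c,
        \sum_(p <- Delta a) \sum_(q <- Delta b) J (p.1 ** q.1) c * J p.2 q.2
        = \sum_(q <- Delta b) \sum_(r <- Delta c) J a (q.1 ** r.1) * J q.2 r.2,
      forall a, J a one = eps a &
      forall a, J one a = eps a].

Definition invariant (J : H -> H -> k) : Prop :=
  forall a b,
    \sum_(p <- Delta a) \sum_(q <- Delta b) J p.1 q.1 *: (p.2 ** q.2)
    = \sum_(p <- Delta a) \sum_(q <- Delta b) J p.2 q.2 *: (p.1 ** q.1).

Definition inv_hopf_2cocycle (J : H -> H -> k) : Prop :=
  hopf_2cocycle J /\ invariant J.

(* J^x, where y = x^-1 *)
Definition gauge (x y : H -> k) (J : H -> H -> k) (a b : H) : k :=
  \sum_(p <- bcomul3 a) \sum_(q <- bcomul3 b)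
    x (p.1.1 ** q.1.1) * J p.1.2 q.1.2 * y p.2 * y q.2.

Definition gauge_equivalent (J K : H -> H -> k) : Prop :=
  exists x y, inverse1 x y /\ forall a b, K a b = gauge x y J a b.

(* H^J with its product J^-1 * m * J, where K = J^-1 *)
Definition twist (J K : H -> H -> k) : bialgData k :=
  @BialgData k H one
    (fun a b => \sum_(p <- bcomul3 a) \sum_(q <- bcomul3 b)
       (K p.1.1 q.1.1 * J p.2 q.2) *: (p.1.2 ** q.1.2))
    Delta eps.

Definition cotriangular (R : H -> H -> k) : Prop :=
  is_hopf /\
  [/\ exists R', inverse2 R R',
      forall h g,
        \sum_(p <- Delta h) \sum_(q <- Delta g) R p.1 q.1 * R q.2 p.2
        = eps g * eps h,
      forall h g l, R h (g ** l) = \sum_(p <- Delta h) R p.1 g * R p.2 l,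
      forall h g l, R (h ** g) l = \sum_(p <- Delta l) R g p.1 * R h p.2 &
      forall h g,
        \sum_(p <- Delta h) \sum_(q <- Delta g) R p.1 q.1 *: (q.2 ** p.2)
        = \sum_(p <- Delta h) \sum_(q <- Delta g) R p.2 q.2 *: (p.1 ** q.1)].

Definition nondegenerate (R : H -> H -> k) : Prop :=
  (forall a, (forall b, R a b = 0) -> a = 0) /\
  (forall b, (forall a, R a b = 0) -> b = 0).

Definition minimal_cotriangular (R : H -> H -> k) : Prop :=
  cotriangular R /\ nondegenerate R.

End Hopf.

(* An affine algebraic group over k is an affine group scheme of finite type
   over k, given by its coordinate ring. *)
Record affAlgGroup (k : fieldType) := AffAlgGroup {
  coordRing : comAlgType k;
  coordComul : coordRing -> seq (coordRing * coordRing);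
  coordCounit : coordRing -> k;
  coordAntipode : coordRing -> coordRing;
  coordData := BialgData (1 : coordRing) *%R coordComul coordCounit;
  coord_bialgebra : is_bialgebra coordData;
  coord_antipode : @is_antipode k coordData coordAntipode;
  coord_fingen : exists s : seq coordRing,
    forall P : coordRing -> Prop,
      {in s, forall f, P f} -> P 1 ->
      (forall (c : k) f g, P f -> P g -> P (c *: f + g)) ->
      (forall f g, P f -> P g -> P (f * g)) ->
      forall f, P f }.

Notation "''O' ( G )" := (coordData G) (at level 8, format "''O' ( G )").

(* A closed subgroup A of G, given by the restriction map O(G) -> O(A), a
   surjective morphism of Hopf algebras *)
Record closedSubgroup (k : fieldType) (G : affAlgGroup k) := ClosedSubgroup {
  subgrp :> affAlgGroup k;
  restr : {lrmorphism coordRing G -> coordRing subgrp};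
  restr_surj : forall f, exists g, restr g = f;
  restr_comul : forall (U : lmodType k)
      (B : coordRing subgrp -> coordRing subgrp -> U),
    bilinear_for *:%R *:%R B -> forall f,
    \sum_(p <- coordComul (restr f)) B p.1 p.2
    = \sum_(p <- coordComul f) B (restr p.1) (restr p.2);
  restr_counit : forall f, coordCounit (restr f) = coordCounit f }.

Section Groups.
Variable k : fieldType.

(* For a commutative k-algebra R, the group G(R) is the set of algebra
   morphisms O(G) -> R; this is its product. *)
Definition ptmul (G : affAlgGroup k) (R : comAlgType k)
    (u v : coordRing G -> R) (f : coordRing G) : R :=
  \sum_(p <- coordComul f) u p.1 * v p.2.

Definition ptinv (G : affAlgGroup k) (R : comAlgType k)
    (u : coordRing G -> R) (f : coordRing G) : R :=
  u (coordAntipode f).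

(* A(R) is a commutative group for every R *)
Definition commutative_group (A : affAlgGroup k) : Prop :=
  forall (R : comAlgType k) (a b : {lrmorphism coordRing A -> R}),
    ptmul a b =1 ptmul b a.

(* A(R) is a normal subgroup of G(R) for every R *)
Definition normal_subgroup (G : affAlgGroup k) (A : closedSubgroup G) : Prop :=
  forall (R : comAlgType k) (g : {lrmorphism coordRing G -> R})
      (a : {lrmorphism coordRing A -> R}),
    exists a' : {lrmorphism coordRing A -> R},
      ptmul (ptmul g (a \o restr A)) (ptinv g) =1 a' \o restr A.

(* Convention: with the product J^-1 * m * J, the form which satisfies the
   axioms of [cotriangular] is the transpose J^-1 * J_21 of J_21^-1 * J (which
   is also the inverse of the latter); J_21^-1 * J itself satisfies the same
   axioms with the two arguments of R exchanged.  Non-degeneracy is insensitive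
   to the transposition. *)
Definition minimal_2cocycle (A : affAlgGroup k)
    (J : 'O(A) -> 'O(A) -> k) : Prop :=
  hopf_2cocycle J /\
  exists K, inverse2 J K /\
    @minimal_cotriangular k (twist J K) (transp (conv2 (transp K) J)).

Definition pullback (G : affAlgGroup k) (A : closedSubgroup G)
    (J : 'O(A) -> 'O(A) -> k) : 'O(G) -> 'O(G) -> k :=
  fun a b => J (restr A a) (restr A b).

(* A = Supp(J), which is determined only up to conjugation *)
Definition is_support (G : affAlgGroup k) (J : 'O(G) -> 'O(G) -> k)
    (A : closedSubgroup G) : Prop :=
  exists JA : 'O(A) -> 'O(A) -> k,
    minimal_2cocycle JA /\ gauge_equivalent J (pullback JA).

End Groups.

(* Main.v *)
(* Let L be the pullback to G of the minimal cocycle JA of A, so that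
   L = (x o m) * J * (y (x) y) with y = x^-1 in O(G)^*, and let L_21, J_21 be the
   transposes.  As J commutes with m, so does
     L_21 * L^-1 = (x o m) * J_21 * J^-1 * (x o m)^-1 = J_21 * J^-1.
   Hence L^-1 * m * L = L_21^-1 * m * L_21, i.e. the twisted product of O(A) is
   commutative.  The pairing Q(h, g) of the minimal cotriangular structure turns
   this product into the coproduct of h, so non-degeneracy makes O(A)
   cocommutative, and A commutative.  Now (O(A) (x) O(A))^* is commutative, so Q
   pulls back to L^-1 * L_21 = L_21 * L^-1, which commutes with m: it is invariant
   under the adjoint action of G.  Therefore so is its radical, the ideal of A. *)
From Stdlib Require Import FunctionalExtensionality.
From HB Require Import structures.
Require Import Defs.
From mathcomp Require Import all_boot all_order all_algebra.
Local Open Scope ring_scope.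

Set Implicit Arguments.
Unset Strict Implicit.
Unset Printing Implicit Defensive.

Import GRing.Theory.

Definition bil (k : fieldType) (U V W : lmodType k) (B : U -> V -> W) : Prop :=
  bilinear_for *:%R *:%R B.

(** * Linear maps and tensors over a field *)

Section Linear.
Variable k : fieldType.

Lemma linear_big (U V : lmodType k) (I : Type) (r : seq I) (F : I -> U -> V) :
  (forall i, linear (F i)) -> linear (fun u => \sum_(i <- r) F i u).
Proof.
move=> F_lin c u v; rewrite scaler_sumr -big_split /=.
by apply: eq_bigr => i _; rewrite F_lin.
Qed.

Lemma linear_zero (U V : lmodType k) (f : U -> V) : linear f -> f 0 = 0.
Proof.
move=> f_lin; have /eqP := f_lin 1 0 0.
by rewrite !scale1r addr0 -subr_eq subrr eq_sym => /eqP.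
Qed.

Lemma linear_scale (U V : lmodType k) (f : U -> V) :
  linear f -> forall c u, f (c *: u) = c *: f u.
Proof.
by move=> f_lin c u; rewrite -[c *: u]addr0 f_lin (linear_zero f_lin) addr0.
Qed.

Lemma linear_add (U V : lmodType k) (f : U -> V) :
  linear f -> forall u v, f (u + v) = f u + f v.
Proof. by move=> f_lin u v; rewrite -[u]scale1r f_lin !scale1r. Qed.

Lemma linear_opp (U V : lmodType k) (f : U -> V) :
  linear f -> forall u, f (- u) = - f u.
Proof. by move=> f_lin u; rewrite -scaleN1r linear_scale // scaleN1r. Qed.

Lemma linear_raw_sum (U V : lmodType k) (f : U -> V) (I : Type) (r : seq I)
    (v : I -> U) :
  linear f -> f (\sum_(i <- r) v i) = \sum_(i <- r) f (v i).
Proof.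
move=> f_lin; elim: r => [|i r IHr]; first by rewrite !big_nil linear_zero.
by rewrite !big_cons linear_add // IHr.
Qed.

Lemma linear_sum_scale (U V : lmodType k) (f : U -> V) (I : Type) (r : seq I)
    (c : I -> k) (v : I -> U) :
  linear f -> f (\sum_(i <- r) c i *: v i) = \sum_(i <- r) c i *: f (v i).
Proof.
move=> f_lin; elim: r => [|i r IHr]; first by rewrite !big_nil linear_zero.
by rewrite !big_cons f_lin IHr.
Qed.

(* If u_0 != 0, a functional with [P b u_0 != 0] expresses v_0 through the other
   v_i, which shortens the tensor. *)
Lemma separated_tensor (U V W : lmodType k) (I : Type) (P : I -> U -> k)
    (B : U -> V -> W) (s : seq (U * V)) :
  (forall b, scalar (P b)) -> (forall u, (forall b, P b u = 0) -> u = 0) ->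
  bil B -> (forall b, \sum_(p <- s) P b p.1 *: p.2 = 0) ->
  \sum_(p <- s) B p.1 p.2 = 0.
Proof.
move=> P_lin P_sep [B_linl B_linr].
elim: {s}(size s) {-2}s (erefl (size s)) => [|n IHn] [|[u v] s] //=.
  by rewrite big_nil.
case=> s_n Ps; have [u0|u_neq0] := eqVneq u 0.
  rewrite big_cons /= u0 (linear_zero (B_linl v)) add0r; apply: IHn => // b.
  by have := Ps b; rewrite big_cons /= u0 (@linear_zero _ k^o _ (P_lin b)) scale0r add0r.
apply/eqP; apply: contraNT u_neq0 => B_neq0; apply/eqP/P_sep => b.
apply/eqP; apply: contraNT B_neq0 => Pbu; apply/eqP.
have vE : v = - \sum_(p <- s) ((P b u)^-1 * P b p.1) *: p.2.
  have /eqP := Ps b; rewrite big_cons /= addr_eq0 => /eqP /(congr1 ( *:%R (P b u)^-1)).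
  rewrite scalerA mulVf // scale1r => ->; rewrite scalerN scaler_sumr.
  by congr (- _); apply: eq_bigr => p _; rewrite scalerA.
(* Substituting [vE] for [v] moves multiples of [u] into the first factors of the remaining terms:
   [s'] is the same tensor, written with one term less. *)
pose s' := [seq (p.1 - ((P b u)^-1 * P b p.1) *: u, p.2) | p <- s].
have Plin c : linear (P c : U -> k^o) := P_lin c.
suff <- : \sum_(p <- s') B p.1 p.2 = \sum_(p <- (u, v) :: s) B p.1 p.2.
  apply: IHn => [|c]; first by rewrite size_map.
  rewrite big_map /= -[RHS](Ps c) big_cons /=.
  have PE w d x : P c (w - d *: u) *: (x : V) = P c w *: x - (d * P c u) *: x.
    rewrite (linear_add (Plin c)) (linear_opp (Plin c)) (linear_scale (Plin c)).
    by rewrite scalerDl scaleNr.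
  rewrite (eq_bigr _ (fun p _ => PE _ _ _)) big_split /= addrC; congr (_ + _).
  rewrite {1}vE scalerN scaler_sumr -sumrN; apply: eq_bigr => p _.
  by rewrite scalerA mulrC.
rewrite big_map big_cons /=.
have BE w d x : B (w - d *: u) x = B w x - d *: B u x.
  by rewrite (linear_add (B_linl x)) (linear_opp (B_linl x)) (linear_scale (B_linl x)).
rewrite (eq_bigr _ (fun p _ => BE _ _ _)) big_split /= addrC; congr (_ + _).
by rewrite {1}vE (linear_opp (B_linr u)) (linear_sum_scale _ _ _ (B_linr u)) -sumrN.
Qed.

End Linear.

(** * The Hopf algebra axioms of the coordinate ring [H] *)

Section Convolution.
Variables (k : fieldType) (G : affAlgGroup k).
Local Notation H := (coordRing G).
Local Notation Delta := (@coordComul k G).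
Local Notation eps := (@coordCounit k G).
Local Notation S := (@coordAntipode k G).

Lemma comul_linear (U : lmodType k) (B : H -> H -> U) :
  bil B -> linear (fun h => \sum_(p <- Delta h) B p.1 p.2).
Proof. by case: (coord_bialgebra G) => -[_ [+ _ _ _ _]] _ _ _ _; apply. Qed.

Lemma comulA (U : lmodType k) (T : H -> H -> H -> U) : trilinear (H := 'O(G)) T ->
  forall h, \sum_(p <- Delta h) \sum_(q <- Delta p.1) T q.1 q.2 p.2
          = \sum_(p <- Delta h) \sum_(q <- Delta p.2) T p.1 q.1 q.2.
Proof. by case: (coord_bialgebra G) => -[_ [_ + _ _ _]] _ _ _ _; apply. Qed.

Lemma counit_linear : linear (eps : H -> k^o).
Proof. by case: (coord_bialgebra G) => -[_ [_ _ + _ _]]. Qed.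

Lemma counitl h : \sum_(p <- Delta h) eps p.1 *: p.2 = h.
Proof. by case: (coord_bialgebra G) => -[_ [_ _ _ + _]] _ _ _ _; apply. Qed.

Lemma counitr h : \sum_(p <- Delta h) eps p.2 *: p.1 = h.
Proof. by case: (coord_bialgebra G) => -[_ [_ _ _ _ +]] _ _ _ _; apply. Qed.

Lemma comul1 (U : lmodType k) (B : H -> H -> U) :
  bil B -> \sum_(p <- Delta 1) B p.1 p.2 = B 1 1.
Proof. by case: (coord_bialgebra G) => _ + _ _ _; apply. Qed.

Lemma comulM (U : lmodType k) (B : H -> H -> U) : bil B ->
  forall a b, \sum_(p <- Delta (a * b)) B p.1 p.2
    = \sum_(p <- Delta a) \sum_(q <- Delta b) B (p.1 * q.1) (p.2 * q.2).
Proof. by case: (coord_bialgebra G) => _ _ + _ _; apply. Qed.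

Lemma counit1 : eps 1 = 1.
Proof. by case: (coord_bialgebra G). Qed.

Lemma counitM a b : eps (a * b) = eps a * eps b.
Proof. by case: (coord_bialgebra G) => _ _ _ _; apply. Qed.

Lemma antipode_linear : linear S.
Proof. by case: (coord_antipode G). Qed.

Lemma antipodel h : \sum_(p <- Delta h) S p.1 * p.2 = eps h *: 1.
Proof. by case: (coord_antipode G) => _ + _; apply. Qed.

Lemma antipoder h : \sum_(p <- Delta h) p.1 * S p.2 = eps h *: 1.
Proof. by case: (coord_antipode G) => _ _; apply. Qed.

(** * The convolution algebra of bilinear maps on [H] with values in [H] *)

Implicit Types F T : H -> H -> H.

Definition convol F1 F2 (a b : H) : H :=
  \sum_(p <- Delta a) \sum_(q <- Delta b) F1 p.1 q.1 * F2 p.2 q.2.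

Local Notation "F1 ** F2" := (convol F1 F2) (at level 40, left associativity).

Lemma funext2 F1 F2 : (forall a b, F1 a b = F2 a b) -> F1 = F2.
Proof.
by move=> eqF; do 2!apply: functional_extensionality => ?; apply: eqF.
Qed.

Lemma convol_bil F1 F2 : bil F1 -> bil F2 -> bil (F1 ** F2).
Proof.
move=> [l1 r1] [l2 r2]; split=> [b|a].
  apply: (comul_linear (B := fun u v => \sum_(q <- Delta b) F1 u q.1 * F2 v q.2)).
  split=> w; apply: linear_big => q c u v.
    by rewrite /= l1 mulrDl scalerAl.
  by rewrite /= l2 mulrDr scalerAr.
rewrite /convol; apply: linear_big => p.
apply: (comul_linear (B := fun u v => F1 p.1 u * F2 p.2 v)).
split=> w c u v /=; first by rewrite r1 mulrDl scalerAl.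
by rewrite r2 mulrDr scalerAr.
Qed.

#[local] Hint Extern 0 (bil (convol _ _)) => apply: convol_bil; trivial : core.

Lemma convolA F1 F2 F3 : bil F1 -> bil F2 -> bil F3 ->
  F1 ** (F2 ** F3) = F1 ** F2 ** F3.
Proof.
move=> [l1 r1] [l2 r2] [l3 r3]; apply: funext2 => a b; symmetry.
(* Coassociativity is used for [a] first, with all sums over [b] hidden in [T], and then for [b]
   with the components of [a] fixed. *)
pose T u v w := \sum_(q <- Delta b) \sum_(q' <- Delta q.1)
  F1 u q'.1 * F2 v q'.2 * F3 w q.2.
transitivity (\sum_(p <- Delta a) \sum_(p' <- Delta p.1) T p'.1 p'.2 p.2).
  apply: eq_bigr => p _; rewrite [RHS]exchange_big; apply: eq_bigr => q _ /=.
  by rewrite mulr_suml; apply: eq_bigr => p' _; rewrite mulr_suml.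
rewrite comulA; last first.
  split=> [v w|u w|u v]; do 2!apply: linear_big => ?; move=> c ? ? /=.
  - by rewrite l1 !mulrDl !scalerAl.
  - by rewrite l2 mulrDr mulrDl -scalerAr -scalerAl.
  - by rewrite l3 mulrDr -scalerAr.
apply: eq_bigr => p _.
transitivity (\sum_(p' <- Delta p.2) \sum_(q <- Delta b)
    \sum_(q' <- Delta q.2) F1 p.1 q.1 * F2 p'.1 q'.1 * F3 p'.2 q'.2).
  apply: eq_bigr => p' _.
  apply: (comulA (T := fun u v w => F1 p.1 u * F2 p'.1 v * F3 p'.2 w)).
  split=> [v w|u w|u v] c ? ? /=.
  - by rewrite r1 !mulrDl !scalerAl.
  - by rewrite r2 mulrDr mulrDl -scalerAr -scalerAl.
  - by rewrite r3 mulrDr -scalerAr.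
rewrite exchange_big; apply: eq_bigr => q _ /=.
rewrite mulr_sumr; apply: eq_bigr => p' _.
by rewrite mulr_sumr; apply: eq_bigr => q' _; rewrite mulrA.
Qed.

(* Scalar forms are regarded as H-valued ones, so that forms and the product
   of H live in a single convolution algebra. *)
Definition scalar_form (B : H -> H -> k) (a b : H) : H := B a b *: 1.

Local Notation "B %:F" := (scalar_form B) (at level 1, format "B %:F").

Lemma scalar_form_bil (B : H -> H -> k) :
  bilinear_for *%R *%R B -> bil B%:F.
Proof.
by move=> [l r]; split=> w c u v; rewrite /scalar_form /= ?l ?r scalerDl scalerA.
Qed.

Lemma convol_scalar B1 B2 :
  B1%:F ** B2%:F = (conv2 (H := 'O(G)) B1 B2)%:F.
Proof.
apply: funext2 => a b; rewrite /scalar_form /conv2 scaler_suml.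
apply: eq_bigr => p _; rewrite scaler_suml; apply: eq_bigr => q _.
by rewrite -scalerAl mul1r scalerA.
Qed.

Definition convol1 : H -> H -> H := (fun a b => eps a * eps b)%:F.

Lemma convol_1l F : bil F -> convol1 ** F = F.
Proof.
move=> [l r]; apply: funext2 => a b.
rewrite -[in RHS](counitl a) (linear_sum_scale _ _ _ (l b)).
apply: eq_bigr => p _; rewrite -[in RHS](counitl b).
rewrite (linear_sum_scale _ _ _ (r _)) scaler_sumr; apply: eq_bigr => q _.
by rewrite -scalerAl mul1r scalerA.
Qed.

Lemma convol_1r F : bil F -> F ** convol1 = F.
Proof.
move=> [l r]; apply: funext2 => a b.
rewrite -[in RHS](counitr a) (linear_sum_scale _ _ _ (l b)).
apply: eq_bigr => p _; rewrite -[in RHS](counitr b).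
rewrite (linear_sum_scale _ _ _ (r _)) scaler_sumr; apply: eq_bigr => q _.
by rewrite -scalerAr mulr1 scalerA.
Qed.

Lemma convol_inv_uniq F F1 F2 : bil F -> bil F1 -> bil F2 ->
  F1 ** F = convol1 -> F ** F2 = convol1 -> F1 = F2.
Proof.
move=> bF bF1 bF2 inv1 inv2.
by rewrite -[F1]convol_1r // -inv2 convolA // inv1 convol_1l.
Qed.

(** Conjugation: F' T = F' T F F' = F' F T F' = T F'. *)
Lemma convol_comm_inv F F' T : bil F -> bil F' -> bil T ->
  F ** F' = convol1 -> F' ** F = convol1 -> F ** T = T ** F ->
  F' ** T = T ** F'.
Proof.
move=> bF bF' bT FF' F'F FT; rewrite -[F' ** T]convol_1r //.
rewrite -FF' convolA // -(convolA bF' bT bF) -FT.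
by rewrite (convolA bF' bF bT) F'F convol_1l.
Qed.

Definition flip F (a b : H) : H := F b a.

Lemma flip_bil F : bil F -> bil (flip F).
Proof. by case=> l r; split. Qed.

(** Exchanging the tensor factors is a coalgebra automorphism of H (x) H, so [flip] is an
    automorphism of the convolution algebra. *)
Lemma flip_convol F1 F2 : flip (F1 ** F2) = flip F1 ** flip F2.
Proof. by apply: funext2 => a b; rewrite /flip /convol exchange_big. Qed.

Lemma flip_convol1 : flip convol1 = convol1.
Proof. by apply: funext2 => a b; rewrite /flip /convol1 /scalar_form mulrC. Qed.

(** * The product of [H] as an element of the convolution algebra, its inverse and its factors *)

Definition mulH : H -> H -> H := *%R.

Lemma mulH_bil : bil mulH.
Proof.
by split=> w c u v; rewrite /mulH /= ?mulrDl ?mulrDr -?scalerAl -?scalerAr.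
Qed.

Lemma flip_mulH : flip mulH = mulH.
Proof. by apply: funext2 => a b; rewrite /flip /mulH mulrC. Qed.

(** The two sides, [F1] and [F2], are a left and a right convolution inverse of [mulH].
    Commutativity of [H] is what puts the factors of [F2] in this order. *)
Lemma antipodeM a b : S (a * b) = S a * S b.
Proof.
pose F1 a b := S (a * b); pose F2 a b := S a * S b.
have S_lin := antipode_linear.
have bF1 : bil F1.
  by split=> w c u v; rewrite /F1 /= ?mulrDl ?mulrDr -?scalerAl -?scalerAr S_lin.
have bF2 : bil F2.
  by split=> w c u v; rewrite /F2 /= S_lin ?mulrDl ?mulrDr -?scalerAl -?scalerAr.
change (F1 a b = F2 a b).
rewrite (convol_inv_uniq mulH_bil bF1 bF2) //; apply: funext2 => {}a {}b.
  transitivity (\sum_(r <- Delta (a * b)) S r.1 * r.2).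
    rewrite (comulM (B := fun u v => S u * v)) //; split=> w c u v /=.
      by rewrite S_lin mulrDl scalerAl.
    by rewrite mulrDr scalerAr.
  by rewrite antipodel counitM.
transitivity ((\sum_(p <- Delta a) p.1 * S p.2) * (\sum_(q <- Delta b) q.1 * S q.2)).
  rewrite mulr_suml; apply: eq_bigr => p _; rewrite mulr_sumr.
  by apply: eq_bigr => q _; rewrite mulrACA.
by rewrite !antipoder -scalerAl mul1r scalerA.
Qed.

Lemma antipode1 : S 1 = 1.
Proof.
have := antipodel 1; rewrite (comul1 (B := fun u v => S u * v)).
  by rewrite counit1 scale1r mulr1.
split=> w c u v /=; first by rewrite antipode_linear mulrDl scalerAl.
by rewrite mulrDr scalerAr.
Qed.

(** The maps f (x) eps and, for [legr], eps (x) f. Convolving with one of them affects a single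
    argument, which splits [mulH] into two factors that can be inverted separately. *)
Definition legl (f : H -> H) (a b : H) : H := eps b *: f a.
Definition legr (f : H -> H) : H -> H -> H := flip (legl f).

Lemma legl_bil f : linear f -> bil (legl f).
Proof.
move=> f_lin; split=> w c u v; rewrite /legl /=.
  by rewrite f_lin scalerDr !scalerA mulrC.
by rewrite counit_linear scalerDl scalerA.
Qed.

Lemma legr_bil f : linear f -> bil (legr f).
Proof. by move=> f_lin; apply/flip_bil/legl_bil. Qed.

Lemma convol_legll f F a b : bil F ->
  (legl f ** F) a b = \sum_(p <- Delta a) f p.1 * F p.2 b.
Proof.
move=> [_ r]; apply: eq_bigr => p _.
rewrite -[in RHS](counitl b) (linear_sum_scale _ _ _ (r _)) mulr_sumr.
by apply: eq_bigr => q _; rewrite -scalerAl scalerAr.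
Qed.

Lemma convol_leglr f F a b : bil F ->
  (F ** legl f) a b = \sum_(p <- Delta a) F p.1 b * f p.2.
Proof.
move=> [_ r]; apply: eq_bigr => p _.
rewrite -[in RHS](counitr b) (linear_sum_scale _ _ _ (r _)) mulr_suml.
by apply: eq_bigr => q _; rewrite -scalerAl scalerAr.
Qed.

Lemma convol_legrl f F a b : bil F ->
  (legr f ** F) a b = \sum_(q <- Delta b) f q.1 * F a q.2.
Proof.
move=> bF; rewrite /legr -[F]/(flip (flip F)) -flip_convol /flip.
by rewrite convol_legll //; apply: flip_bil.
Qed.

Lemma convol_legrr f F a b : bil F ->
  (F ** legr f) a b = \sum_(q <- Delta b) F a q.1 * f q.2.
Proof.
move=> bF; rewrite /legr -[F]/(flip (flip F)) -flip_convol /flip.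
by rewrite convol_leglr //; apply: flip_bil.
Qed.

Lemma id_linear : linear (id : H -> H). Proof. by []. Qed.

Lemma legl_legr : legl id ** legr id = mulH.
Proof.
apply: funext2 => a b; rewrite convol_legll; last exact: (legr_bil id_linear).
rewrite -[a in RHS]counitr /mulH mulr_suml; apply: eq_bigr => p _.
by rewrite /legr /flip /legl -scalerAl scalerAr.
Qed.

Lemma legr_legl : legr id ** legl id = mulH.
Proof. by rewrite -flip_mulH -legl_legr flip_convol. Qed.

Lemma legl_antipode : legl id ** legl S = convol1.
Proof.
apply: funext2 => a b; rewrite convol_legll; last exact/legl_bil/antipode_linear.
rewrite /convol1 /scalar_form mulrC -scalerA -antipoder scaler_sumr.
by apply: eq_bigr => p _; rewrite /legl scalerAr.
Qed.

Lemma legr_antipode : legr S ** legr id = convol1.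
Proof.
apply: funext2 => a b; rewrite convol_legrl; last exact: (legr_bil id_linear).
rewrite /convol1 /scalar_form -scalerA -antipodel scaler_sumr.
by apply: eq_bigr => p _; rewrite /legr /flip /legl scalerAr.
Qed.

(** With l = [legl id] and r = [legr id], [mulH] is both l r and r l, so r l F = F r l gives l F
    l^-1 = r^-1 F r. On the left [F] is evaluated at components of [a], on the right only at [a]
    itself; hence whatever lies in the left radical of [F] is controlled under the adjoint
    coaction. *)
Lemma conj_leg F : bil F -> F ** mulH = mulH ** F ->
  legl id ** F ** legl S = legr S ** F ** legr id.
Proof.
move=> bF Fm; have S_lin := antipode_linear.
have [bl br bSl bSr] : [/\ bil (legl id), bil (legr id), bil (legl S) & bil (legr S)].
  by split; (apply: legl_bil || apply: legr_bil) => //; apply: id_linear.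
rewrite -[RHS]convol_1r // -legl_antipode convolA // -(convolA _ br bl) //.
rewrite legr_legl -(convolA bSr bF mulH_bil) Fm -legr_legl.
rewrite (convolA bSr) // (convolA bSr) // legr_antipode.
by rewrite convol_1l.
Qed.

(** Writing [flip L] as [flip L ** L' ** L] lets the commutator [flip L ** L'] move to the left of
    [mulH], where [flip L'] cancels [flip L]. *)
Lemma twist_commutative L L' : bil L -> bil L' ->
  L ** L' = convol1 -> L' ** L = convol1 ->
  flip L ** L' ** mulH = mulH ** (flip L ** L') ->
  flip (L' ** (mulH ** L)) = L' ** (mulH ** L).
Proof.
move=> bL bL' LL' L'L comm; have bm := mulH_bil.
have [bfL bfL'] := (flip_bil bL, flip_bil bL').
rewrite !flip_convol flip_mulH -[mulH ** flip L]convol_1r // -L'L.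
rewrite (convolA _ bL' bL) // -(convolA bm bfL bL') -comm.
rewrite -(convolA bfL bL' bm) -(convolA _ _ bL) // -(convolA bL' bm bL).
rewrite (convolA bfL') // -flip_convol L'L flip_convol1 convol_1l //.
Qed.

(** Apply [x] to the values of both sides: the scalars of [B] come out by linearity. For [F] =
    [mulH] this shows that an invariant form commutes with x o m. *)
Lemma convol_scalar_comp (x : H -> k) B F : scalar x ->
  B%:F ** F = F ** B%:F -> let xF := (fun a b => x (F a b))%:F in
  B%:F ** xF = xF ** B%:F.
Proof.
move=> x_lin BF; have xl : linear (x : H -> k^o) := x_lin.
have xE (v : k) a : x (v *: a) = v * x a := linear_scale xl v a.
have xsum2 a b (D : H * H -> H * H -> H) :
    x (\sum_(p <- Delta a) \sum_(q <- Delta b) D p q)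
      = \sum_(p <- Delta a) \sum_(q <- Delta b) x (D p q).
  rewrite (linear_raw_sum _ _ xl); apply: eq_bigr => p _.
  by rewrite (linear_raw_sum _ _ xl).
apply: funext2 => a b; have := congr1 (fun T => x (T a b) *: (1 : H)) BF.
rewrite /convol !xsum2 !scaler_suml.
rewrite (eq_bigr (fun p => \sum_(q <- Delta b) B%:F p.1 q.1 * (x (F p.2 q.2) *: 1))).
  move=> ->; apply: eq_bigr => p _; rewrite scaler_suml; apply: eq_bigr => q _.
  by rewrite /scalar_form -scalerAr mulr1 xE -scalerAl mul1r scalerA mulrC.
move=> p _; rewrite scaler_suml; apply: eq_bigr => q _.
by rewrite /scalar_form -!scalerAl !mul1r xE scalerA.
Qed.

(* With X = x(ab), Y = y(ab), XX = x(a)x(b), YY = y(a)y(b), where y is the inverse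
   of x, the gauge transform of J is X ** J ** YY. *)
Lemma gauge_commutator (J J' X Y XX YY L' : H -> H -> H) :
  bil J -> bil J' -> bil X -> bil Y -> bil XX -> bil YY -> bil L' ->
  J' ** J = convol1 -> J ** J' = convol1 -> X ** Y = convol1 ->
  YY ** XX = convol1 -> XX ** YY = convol1 ->
  flip X = X -> flip YY = YY -> J ** X = X ** J ->
  L' ** (X ** (J ** YY)) = convol1 ->
  flip (X ** (J ** YY)) ** L' = flip J ** J'.
Proof.
move=> bJ bJ' bX bY bXX bYY bL' J'J JJ' XY YYXX XXYY fX fYY JX L'L.
have bfJ := flip_bil bJ.
(* [L'] is a left inverse of [X ** (J ** YY)], and the right-hand side is a right inverse. *)
have L'E : L' = XX ** (J' ** Y).
  apply: convol_inv_uniq L'L _ => //.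
  rewrite -(convolA bX) // -(convolA bJ) // (convolA bYY bXX) // YYXX.
  by rewrite (convol_1l (F := J' ** Y)) // (convolA bJ) // JJ' convol_1l.
(* After [YY ** XX] cancels, X J_21 J' Y remains. [X] commutes with [J'] and, being symmetric, with
   [flip J], so it moves right to cancel [Y]. *)
rewrite !flip_convol fX fYY L'E -(convolA bX) // -(convolA bfJ) //.
rewrite (convolA bYY bXX) // YYXX (convol_1l (F := J' ** Y)) //.
have J'X := convol_comm_inv bJ bJ' bX JJ' J'J JX.
have fJX : flip J ** X = X ** flip J by rewrite -{1}fX -flip_convol JX flip_convol fX.
rewrite (convolA bfJ) // (convolA bX) // (convolA bX) // -fJX.
rewrite -(convolA bfJ bX) // -J'X -(convolA bfJ) // -(convolA bJ') // XY.
by rewrite convol_1r.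
Qed.

(** * Gauge transforms, twists, invariance and inverses as convolution identities *)

Lemma convol3E F1 F2 F3 a b :
  (F1 ** (F2 ** F3)) a b =
  \sum_(p <- bcomul3 (a : 'O(G))) \sum_(q <- bcomul3 (b : 'O(G)))
    F1 p.1.1 q.1.1 * (F2 p.1.2 q.1.2 * F3 p.2 q.2).
Proof.
rewrite big_allpairs_dep; apply: eq_bigr => p _ /=.
under [RHS]eq_bigr => p' _ do rewrite big_allpairs_dep.
rewrite [RHS]exchange_big; apply: eq_bigr => q _ /=.
by rewrite mulr_sumr; apply: eq_bigr => p' _; rewrite mulr_sumr.
Qed.

Lemma gauge_convol (x y : H -> k) (B : H -> H -> k) :
  (gauge (H := 'O(G)) x y B)%:F =
  (fun a b => x (a * b))%:F ** (B%:F ** (fun a b => y a * y b)%:F).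
Proof.
apply: funext2 => a b; rewrite convol3E {1}/scalar_form /gauge scaler_suml.
apply: eq_bigr => p _; rewrite scaler_suml; apply: eq_bigr => q _.
by rewrite /scalar_form -!scalerAl !mul1r !scalerA !mulrA.
Qed.

Lemma twist_convol (B K : H -> H -> k) a b :
  bmul (b := twist (H := 'O(G)) B K) a b = (K%:F ** (mulH ** B%:F)) a b.
Proof.
rewrite convol3E; apply: eq_bigr => p _; apply: eq_bigr => q _.
by rewrite /scalar_form /mulH -!scalerAl mul1r -scalerAr mulr1 scalerA.
Qed.

Lemma invariant_convol (B : H -> H -> k) :
  Defs.invariant (H := 'O(G)) B -> B%:F ** mulH = mulH ** B%:F.
Proof.
move=> B_inv; apply: funext2 => a b; have := B_inv a b => /= eqB.
transitivity (\sum_(p <- Delta a) \sum_(q <- Delta b) B p.1 q.1 *: (p.2 * q.2)).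
  do 2!apply: eq_bigr => ? _; by rewrite /scalar_form -scalerAl mul1r.
rewrite eqB; do 2!apply: eq_bigr => ? _.
by rewrite /scalar_form -scalerAr mulr1.
Qed.

Lemma inverse_convol (B K : H -> H -> k) : inverse2 (H := 'O(G)) B K ->
  [/\ bil B%:F, bil K%:F, B%:F ** K%:F = convol1 & K%:F ** B%:F = convol1].
Proof.
case=> bB bK BK KB; split; [exact: scalar_form_bil| exact: scalar_form_bil|..];
  by rewrite convol_scalar; apply: funext2 => a b; rewrite /scalar_form ?BK ?KB.
Qed.

Lemma scalar_mulH_bil (x : H -> k) : scalar x -> bil (fun a b => x (a * b))%:F.
Proof.
move=> x_lin; apply: scalar_form_bil; split=> w c u v /=.
  by rewrite mulrDl -scalerAl x_lin.
by rewrite mulrDr -scalerAr x_lin.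
Qed.

Lemma scalar_tensor_bil (x : H -> k) : scalar x -> bil (fun a b => x a * x b)%:F.
Proof.
move=> x_lin; apply: scalar_form_bil; split=> w c u v /=; rewrite x_lin.
  by rewrite mulrDl mulrA.
by rewrite mulrDr mulrCA.
Qed.

Lemma convol_mulH (x y : H -> k) : inverse1 (H := 'O(G)) x y ->
  (fun a b => x (a * b))%:F ** (fun a b => y (a * b))%:F = convol1.
Proof.
case=> x_lin y_lin xy _; rewrite convol_scalar; congr scalar_form.
apply: functional_extensionality => a; apply: functional_extensionality => b.
transitivity (conv1 (H := 'O(G)) x y (a * b)); last by rewrite xy; apply: counitM.
rewrite /conv1 /conv2 /= (comulM (U := k^o) (B := fun u v => x u * y v)) //.
split=> w c u v /=; first by rewrite x_lin mulrDl /GRing.scale /= mulrA.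
by rewrite y_lin mulrDr /GRing.scale /= mulrCA.
Qed.

Lemma convol_tensor (x y : H -> k) : inverse1 (H := 'O(G)) x y ->
  (fun a b => x a * x b)%:F ** (fun a b => y a * y b)%:F = convol1.
Proof.
case=> x_lin y_lin xy _; rewrite convol_scalar; congr scalar_form.
apply: functional_extensionality => a; apply: functional_extensionality => b.
transitivity (conv1 (H := 'O(G)) x y a * conv1 (H := 'O(G)) x y b); last by rewrite !xy.
rewrite /conv1 /conv2 /= mulr_suml.
apply: eq_bigr => p _; rewrite mulr_sumr; apply: eq_bigr => q _.
by rewrite mulrACA.
Qed.

Lemma inverse1_sym (x y : H -> k) :
  inverse1 (H := 'O(G)) x y -> inverse1 (H := 'O(G)) y x.
Proof. by case. Qed.

(** Pairing the two legs of the coproduct of [h] minus its opposite with [g] and [l] gives Q(h, m g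
    l) - Q(h, m l g) = 0. Non-degeneracy separates the first legs through [separated_tensor], then
    the second ones directly. *)
Lemma pairing_cocommutative (Q : H -> H -> k) (m : H -> H -> H) :
  bilinear_for *%R *%R Q -> Defs.nondegenerate (H := 'O(G)) Q ->
  (forall g l, m g l = m l g) ->
  (forall h g l, Q h (m g l) = \sum_(p <- Delta h) Q p.1 g * Q p.2 l) ->
  forall (U : lmodType k) (B : H -> H -> U), bil B ->
  forall h, \sum_(p <- Delta h) B p.1 p.2 = \sum_(p <- Delta h) B p.2 p.1.
Proof.
move=> [Ql Qr] [Q_sep _] mC Qm U B bB h.
have Qlin b : linear (Q^~ b : H -> k^o) := Ql b.
(* The coproduct of [h] minus its opposite, as a list of pairs with the sign carried by the first
   component. *)
pose s := Delta h ++ [seq (- p.2, p.1) | p <- Delta h].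
have sE (V : lmodType k) (C : H -> H -> V) : bil C ->
    \sum_(p <- s) C p.1 p.2
      = \sum_(p <- Delta h) C p.1 p.2 - \sum_(p <- Delta h) C p.2 p.1.
  move=> [Cl Cr]; rewrite big_cat big_map /= -sumrN; congr (_ + _).
  by apply: eq_bigr => p _; rewrite (linear_opp (Cl _)).
have QQ_bil g : bil (fun u v : H => Q u g *: v).
  by split=> w c u v /=; rewrite ?Ql ?scalerDl ?scalerDr ?scalerA // mulrC.
apply/eqP; rewrite -subr_eq0 -sE //; apply/eqP.
apply: (separated_tensor (P := fun b u => Q u b)) => // g.
have /= -> := sE _ _ (QQ_bil g); apply: Q_sep => l.
rewrite (linear_add (Qlin l)) (linear_opp (Qlin l)).
rewrite !(linear_sum_scale _ _ _ (Qlin l)).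
apply/eqP; rewrite subr_eq0; apply/eqP.
transitivity (Q h (m g l)); first by rewrite Qm.
by rewrite mC Qm; apply: eq_bigr => p _; rewrite mulrC.
Qed.

End Convolution.

Local Notation "B %:F" := (scalar_form B) (at level 1, format "B %:F").

#[local] Hint Extern 0 (bil (convol _ _)) => apply: convol_bil; trivial : core.

(** * Convolution identities along the restriction to a closed subgroup *)

Section Subgroup.
Variables (k : fieldType) (G : affAlgGroup k) (A : closedSubgroup G).
Local Notation rho := (restr A).

Lemma convol_restr (F1 F2 : coordRing A -> coordRing A -> coordRing A)
    (F1' F2' : coordRing G -> coordRing G -> coordRing G) :
  bil F1 -> bil F2 ->
  (forall a b, F1 (rho a) (rho b) = rho (F1' a b)) ->
  (forall a b, F2 (rho a) (rho b) = rho (F2' a b)) ->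
  forall a b, convol F1 F2 (rho a) (rho b) = rho (convol F1' F2' a b).
Proof.
move=> [l1 r1] [l2 r2] E1 E2 a b; rewrite /convol.
rewrite (restr_comul
  (B := fun u v => \sum_(q <- coordComul (rho b)) F1 u q.1 * F2 v q.2)).
  rewrite rmorph_sum; apply: eq_bigr => p _ /=.
  rewrite (restr_comul (B := fun u v => F1 (rho p.1) u * F2 (rho p.2) v)).
    by rewrite rmorph_sum; apply: eq_bigr => q _ /=; rewrite rmorphM E1 E2.
  split=> w c u v /=; first by rewrite r1 mulrDl -scalerAl.
  by rewrite r2 mulrDr -scalerAr.
split=> w; apply: linear_big => q c u v /=; first by rewrite l1 mulrDl -scalerAl.
by rewrite l2 mulrDr -scalerAr.
Qed.

Lemma pullback_form (B : 'O(A) -> 'O(A) -> k) a b :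
  B%:F (rho a) (rho b) = rho ((pullback (A := A) B)%:F a b).
Proof. by rewrite /scalar_form linearZ rmorph1. Qed.

Lemma pullback_conv2 (B1 B2 : 'O(A) -> 'O(A) -> k) :
  bilinear_for *%R *%R B1 -> bilinear_for *%R *%R B2 ->
  (pullback (A := A) (conv2 B1 B2))%:F
  = convol (pullback (A := A) B1)%:F (pullback (A := A) B2)%:F.
Proof.
move=> b1 b2; apply: funext2 => a b; rewrite convol_scalar /scalar_form; congr (_ *: _).
have := convol_restr (scalar_form_bil b1) (scalar_form_bil b2)
  (pullback_form B1) (pullback_form B2) a b.
rewrite !convol_scalar /scalar_form linearZ rmorph1.
(* The counit sends [1] to 1, so it recovers a scalar [c] from [c *: 1]. *)
move/(congr1 (@coordCounit k A)); rewrite !(linear_scale (@counit_linear k A)).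
by rewrite counit1 /GRing.scale /= !mulr1.
Qed.

Lemma pullback_inverse (B K : 'O(A) -> 'O(A) -> k) : inverse2 B K ->
  let L := (pullback (A := A) B)%:F in let L' := (pullback (A := A) K)%:F in
  [/\ bil L, bil L', convol L L' = @convol1 k G & convol L' L = @convol1 k G].
Proof.
move=> [[Bl Br] [Kl Kr] BK KB].
have bB : bilinear_for *%R *%R (pullback (A := A) B).
  by split=> w c u v; rewrite /pullback /= linearP ?Bl ?Br.
have bK : bilinear_for *%R *%R (pullback (A := A) K).
  by split=> w c u v; rewrite /pullback /= linearP ?Kl ?Kr.
split; [exact: scalar_form_bil|exact: scalar_form_bil|..];
  rewrite -pullback_conv2 //; apply: funext2 => a b;
  by rewrite /convol1 /scalar_form /pullback ?BK ?KB -!(@restr_counit k G A).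
Qed.

(** This lifts the twisted product of the subgroup to a convolution over [G], where the invariance
    of the original cocycle can be used. *)
Lemma twist_restr (B K : 'O(A) -> 'O(A) -> k) : inverse2 B K ->
  forall a b, bmul (b := twist B K) (rho a) (rho b)
    = rho (convol (pullback (A := A) K)%:F
            (convol (@mulH k G) (pullback (A := A) B)%:F) a b).
Proof.
move=> BK a b; have [bB bK _ _] := inverse_convol BK.
have bm := @mulH_bil k A; rewrite twist_convol.
apply: convol_restr => // {}a {}b; first exact: pullback_form.
by apply: convol_restr => // {}a {}b; rewrite ?pullback_form // /mulH rmorphM.
Qed.

End Subgroup.

(** * Points with values in a commutative algebra, and their descent to a subgroup *)

Section Points.
Variables (k : fieldType) (G : affAlgGroup k) (R : comAlgType k).
Implicit Types u v : coordRing G -> R.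

(** A predicate on bare functions, because [ptmul] and [ptinv] return functions without a bundled
    morphism structure. *)
Definition algebra_morphism u : Prop := [/\ linear u, u 1 = 1 & {morph u : a b / a * b}].

Lemma ptmul_morphism u v :
  algebra_morphism u -> algebra_morphism v -> algebra_morphism (ptmul u v).
Proof.
move=> [ul u1 uM] [vl v1 vM].
have uv_bil : bil (fun a b => u a * v b).
  by split=> w c a b /=; rewrite ?ul ?vl ?mulrDl ?mulrDr -?scalerAl -?scalerAr.
split=> [||a b].
- exact: (comul_linear uv_bil).
- by rewrite /ptmul (comul1 uv_bil) u1 v1 mulr1.
rewrite /ptmul (comulM uv_bil) mulr_suml; apply: eq_bigr => p _.
by rewrite mulr_sumr; apply: eq_bigr => q _; rewrite uM vM mulrACA.
Qed.

Lemma ptinv_morphism u : algebra_morphism u -> algebra_morphism (ptinv u).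
Proof.
move=> [ul u1 uM]; split=> [c a b||a b]; rewrite /ptinv.
- by rewrite antipode_linear ul.
- by rewrite antipode1.
by rewrite antipodeM uM.
Qed.

Lemma algebra_morphism_descend (A : closedSubgroup G) u :
  algebra_morphism u -> (forall f, restr A f = 0 -> u f = 0) ->
  exists v : {lrmorphism coordRing A -> R}, u =1 v \o restr A.
Proof.
move=> [ul u1 uM] u_ker.
(* The boolean equality allows [xchoose] to select a preimage; the choice is harmless because [u]
   kills the kernel of the restriction. *)
have surj f : exists g, restr A g == f by have [g <-] := restr_surj f; exists g.
pose lift f := xchoose (surj f); pose v f := u (lift f).
have vE f : v (restr A f) = u f.
  apply/eqP; rewrite -subr_eq0 -(linear_opp ul) -(linear_add ul); apply/eqP/u_ker.
  by rewrite raddfB /= (eqP (xchooseP (surj _))) subrr.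
have v_lin : linear v.
  move=> c f g; have [[f' <-] [g' <-]] := (restr_surj f, restr_surj g).
  by rewrite -linearP !vE ul.
have v_mul : GRing.monoid_morphism v.
  split=> [|f g]; first by rewrite -(rmorph1 (restr A)) vE.
  have [[f' <-] [g' <-]] := (restr_surj f, restr_surj g).
  by rewrite -rmorphM !vE uM.
pose vl := GRing.isLinear.Build k (coordRing A) R *:%R v v_lin.
pose vm := GRing.isMonoidMorphism.Build (coordRing A) R v v_mul.
pose v' : {lrmorphism coordRing A -> R} := HB.pack v vl vm.
by exists v' => f; rewrite /= -vE.
Qed.

End Points.

(** * The support of an invariant cocycle *)

Section Support.
Variables (k : fieldType) (G : affAlgGroup k) (A : closedSubgroup G).
Variables (J : 'O(G) -> 'O(G) -> k) (JA K : 'O(A) -> 'O(A) -> k).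
Hypotheses (J_inv : inv_hopf_2cocycle J) (JAK : inverse2 JA K).
Hypothesis J_gauge : gauge_equivalent J (pullback JA).
Local Notation L := (pullback (A := A) JA)%:F.
Local Notation L' := (pullback (A := A) K)%:F.
Local Notation m := (@mulH k G).

Lemma commutator_invariant :
  convol (convol (flip L) L') m = convol m (convol (flip L) L').
Proof.
have [[[J' JJ'] _ _ _] Jinv] := J_inv.
have [bJ bJ' JJ'1 J'J1] := inverse_convol JJ'.
have Jm := invariant_convol Jinv; have bm := @mulH_bil k G.
have [x [y [xy LE]]] := J_gauge; have [x_lin y_lin _ _] := xy.
have yx := inverse1_sym xy.
have [bL bL' _ L'L] := pullback_inverse JAK.
have eqL : L = (gauge x y J)%:F.
  by apply: funext2 => a b; rewrite /scalar_form -LE.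
have J'm := convol_comm_inv bJ bJ' bm JJ'1 J'J1 Jm.
have fJm : convol (flip J%:F) m = convol m (flip J%:F).
  by rewrite -{1}(flip_mulH G) -flip_convol Jm flip_convol flip_mulH.
have bfJ := flip_bil bJ.
have -> : convol (flip L) L' = convol (flip J%:F) J'%:F.
  rewrite eqL gauge_convol.
  (* The two forms supplied are the inverses of x o m and y (x) y; the goal itself does not
     determine them. *)
  apply: (@gauge_commutator _ _ _ _ _
    (fun a b => y (a * b))%:F (fun a b => x a * x b)%:F) => //.
  - exact: scalar_mulH_bil.
  - exact: scalar_mulH_bil.
  - exact: scalar_tensor_bil.
  - exact: scalar_tensor_bil.
  - exact: convol_mulH.
  - exact: convol_tensor.
  - exact: convol_tensor.
  - by apply: funext2 => a b; rewrite /flip /scalar_form mulrC.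
  - by apply: funext2 => a b; rewrite /flip /scalar_form mulrC.
  - exact: (convol_scalar_comp x_lin Jm).
  - by rewrite -gauge_convol -eqL.
by rewrite -(convolA bfJ) // J'm (convolA bfJ) // fJm -(convolA bm).
Qed.

Lemma support_twist_commutative a b :
  bmul (b := twist JA K) a b = bmul (b := twist JA K) b a.
Proof.
have [[a' <-] [b' <-]] := (restr_surj a, restr_surj b).
have [bL bL' LL' L'L] := pullback_inverse JAK.
(* Both products are now restrictions of values of one convolution over [G], which is symmetric in
   its arguments. *)
rewrite !twist_restr //; congr (restr A _).
by rewrite -{1}(twist_commutative bL bL' LL' L'L commutator_invariant).
Qed.

Hypothesis min : @minimal_cotriangular k (twist JA K) (transp (conv2 (transp K) JA)).
(** As [K] is the inverse of [JA], this is JA^-1 * JA_21. *)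
Let Q : coordRing A -> coordRing A -> k := transp (conv2 (transp K) JA).

Lemma support_pairing_bilinear : bilinear_for *%R *%R Q.
Proof. by case: min => -[_ [[R' []]]]. Qed.

Lemma support_cocommutative (U : lmodType k) (B : coordRing A -> coordRing A -> U) :
  bil B -> forall h, \sum_(p <- coordComul h) B p.1 p.2
                   = \sum_(p <- coordComul h) B p.2 p.1.
Proof.
move=> bB; case: min => -[_ [_ _ hex _ _]] nondeg.
exact: (pairing_cocommutative support_pairing_bilinear nondeg
  support_twist_commutative hex bB).
Qed.

Lemma support_pairing_invariant :
  convol (pullback (A := A) Q)%:F m = convol m (pullback (A := A) Q)%:F.
Proof.
have [[Jl Jr] [Kl Kr] _ _] := JAK.
have bfJ : bilinear_for *%R *%R (transp JA) by split.
(* Cocommutativity, applied to one argument after the other, exchanges the two factors of [Q]; the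
   right-hand side pulls back to the commutator [flip L] * [L']. *)
suff eqQ : Q = conv2 (transp JA) K.
  by rewrite eqQ (pullback_conv2 bfJ) //; apply: commutator_invariant.
apply: functional_extensionality => a; apply: functional_extensionality => b.
rewrite /Q /transp /conv2 exchange_big /=.
rewrite (@support_cocommutative k^o
  (fun u v => \sum_(q <- coordComul b) K u q.1 * JA q.2 v)).
  apply: eq_bigr => p _.
  rewrite (@support_cocommutative k^o (fun u v => K p.2 u * JA v p.1)).
    by apply: eq_bigr => q _; rewrite mulrC.
  split=> w c u v /=; first by rewrite Kr mulrDl /GRing.scale /= mulrA.
  by rewrite Jl mulrDr /GRing.scale /= mulrCA.
split=> w; apply: (@linear_big _ _ k^o) => q c u v /=.
  by rewrite Kl mulrDl /GRing.scale /= mulrA.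
by rewrite Jr mulrDr /GRing.scale /= mulrCA.
Qed.

(** The tensor is rho(f_2) (x) f_1 S(f_3), with rho the restriction to [A]: the adjoint coaction on
    [f], restricted in one leg. Pairing that leg with rho(b') under [Q] gives the left side of
    [conj_leg] at (f, b'), while the right side vanishes because [Q] sees [f] only through rho(f) =
    0. Non-degeneracy of [Q] then kills the tensor. *)
Lemma support_adjoint_stable (f : coordRing G) : restr A f = 0 ->
  forall (U : lmodType k) (B : coordRing A -> coordRing G -> U), bil B ->
  \sum_(p <- coordComul f) \sum_(q <- coordComul p.1)
    B (restr A q.2) (q.1 * coordAntipode p.2) = 0.
Proof.
move=> f0 U B bB; have [Ql Qr] := support_pairing_bilinear.
pose w := (pullback (A := A) Q)%:F.
have bw : bil w.
  by apply: scalar_form_bil; split=> v c x y; rewrite /pullback /= linearP ?Ql ?Qr.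
have bid := @id_linear k G; have S_lin := @antipode_linear k G.
pose s := [seq (restr A q.2, q.1 * coordAntipode p.2)
            | p <- coordComul f, q <- coordComul p.1].
have sE (V : lmodType k) (C : coordRing A -> coordRing G -> V) :
    \sum_(p <- s) C p.1 p.2 = \sum_(p <- coordComul f) \sum_(q <- coordComul p.1)
      C (restr A q.2) (q.1 * coordAntipode p.2) by rewrite big_allpairs_dep.
rewrite -sE; apply: (separated_tensor (P := fun b u => Q u b)) => //.
- by case: min => _ [].
move=> b; have [b' <-] := restr_surj b.
have /= -> := sE _ (fun u v => Q u (restr A b') *: v).
have := congr1 (fun F => F f b') (conj_leg bw support_pairing_invariant).
rewrite convol_leglr; last exact/convol_bil/bw/legl_bil.
rewrite convol_legrr; last exact/convol_bil/bw/legr_bil.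
have w0 c : w f c = 0.
  by rewrite /w /scalar_form /pullback f0 (@linear_zero _ _ k^o _ (Ql _)) scale0r.
(* The right side of [conj_leg] is the sum of S(b_1) w(f, b_2) b_3 over the components of [b'], and
   each w(f, b_2) is zero. *)
rewrite [RHS]big1 => [eq0|q _]; last first.
  by rewrite convol_legrl // big1 ?mul0r // => q' _; rewrite w0 mulr0.
rewrite -[RHS]eq0; apply: eq_bigr => p _.
rewrite convol_legll // mulr_suml; apply: eq_bigr => q _.
by rewrite /w /scalar_form /pullback -scalerAr mulr1 scalerAl.
Qed.

Lemma support_commutative : commutative_group A.
Proof.
move=> R a b f; rewrite /ptmul.
rewrite (support_cocommutative (B := fun u v => a u * b v)).
  by apply: eq_bigr => p _; rewrite mulrC.
by split=> w c u v /=; rewrite linearP ?mulrDl ?mulrDr -?scalerAl -?scalerAr.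
Qed.

Lemma support_normal : normal_subgroup A.
Proof.
move=> R g a.
have mor_g : algebra_morphism g.
  by split=> [||x y]; [exact: linearP|exact: rmorph1|exact: rmorphM].
have mor_a : algebra_morphism (a \o restr A).
  by split=> [c x y||x y] /=; rewrite ?linearP ?rmorph1 ?rmorphM.
apply: algebra_morphism_descend => [|f f0].
  exact: ptmul_morphism (ptmul_morphism mor_g mor_a) (ptinv_morphism mor_g).
(* The value of g a g^-1 at [f] is the sum of g(f_1) a(rho f_2) g(S f_3). As [g] is multiplicative
   and [R] commutative, this is a (x) g applied to the adjoint tensor of [f]. *)
rewrite -[RHS](support_adjoint_stable f0 (B := fun u v => a u * g v)).
  apply: eq_bigr => p _; rewrite mulr_suml; apply: eq_bigr => q _.
  by rewrite /= rmorphM mulrCA mulrA.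
by split=> w c u v /=; rewrite linearP ?mulrDl ?mulrDr -?scalerAl -?scalerAr.
Qed.

End Support.

Theorem theorem4p2 (k : closedFieldType) (G : affAlgGroup k)
  (J : 'O(G) -> 'O(G) -> k) (J_inv : inv_hopf_2cocycle J)
  (A : closedSubgroup G) (A_supp : is_support J A) :
  normal_subgroup A /\ commutative_group A.
Proof.
have [JA [[_ [K [JAK min]]] J_gauge]] := A_supp.
split; first exact: support_normal J_inv JAK J_gauge min.
exact: support_commutative J_inv JAK J_gauge min.
Qed.
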